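(* Let $G=(V,E)$ be a finite connected undirected simple graph, let $\mathcal{X}=\{0,1,\ldots,m-1\}$ be a finite state space, and let $\theta^*\in\mathbb{R}^{\mathcal{I}}$ be an arbitrary real parameter vector of a pairwise model on $G$, with log partition function $\Phi(\theta^* )$. Let $\mu_e=\{\mu_{st}\mid (s,t)\in E\}$ be an arbitrary element of the spanning tree polytope $\mathbb{T}(G)$ with $\mu_{st}>0$ for every edge $(s,t)\in E$. Then the function $$\mathcal{F}(\mathbf{T};\mu_e;\theta^* )=-\sum_{s\in V}H_s(T_s)+\sum_{(s,t)\in E}\mu_{st}\,I_{st}(T_{st})-\sum_{\alpha\in\mathcal{I}}T_\alpha\theta^*_\alpha$$ is convex as a function of $\mathbf{T}\in\mathbb{C}$, where $\mathbb{C}$ is the set of locally consistent pseudomarginals. Moreover, the log partition function is bounded above as $$\Phi(\theta^* )\le-\min_{\mathbf{T}\in\mathbb{C}}\mathcal{F}(\mathbf{T};\mu_e;\theta^* ),$$ and this global minimum is attained at a unique vector $\widehat{\mathbf{T}}=\widehat{\mathbf{T}}(\mu_e)\in\mathbb{C}$.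
   Context: Model. Let $N=|V|$ and fix one orientation $(s,t)$ for each edge, so each undirected edge is listed once in $E$. The index set is $\mathcal{I}=\{(s;j)\mid s\in V,\ j\in\mathcal{X}\}\cup\{(st;jk)\mid (s,t)\in E,\ j,k\in\mathcal{X}\}$. The potentials on $\mathbf{x}=(x_s)_{s\in V}\in\mathcal{X}^N$ are the indicator functions $\phi_{s;j}(\mathbf{x})=\delta(x_s=j)$ and $\phi_{st;jk}(\mathbf{x})=\delta(x_s=j,\,x_t=k)$. For $\theta\in\mathbb{R}^{\mathcal{I}}$ the log partition function is $$\Phi(\theta)=\log\sum_{\mathbf{x}\in\mathcal{X}^N}\exp\Big\{\sum_{\alpha\in\mathcal{I}}\theta_\alpha\phi_\alpha(\mathbf{x})\Big\}.$$ Spanning tree polytope. Let $\mathfrak{T}$ be the set of spanning trees of $G$. For a probability distribution $\vec\mu=\{\mu(\mathcal{T})\}_{\mathcal{T}\in\mathfrak{T}}$ on $\mathfrak{T}$, the edge appearance probability of $e\in E$ is $\sum_{\mathcal{T}\in\mathfrak{T}:\,e\in E(\mathcal{T})}\mu(\mathcal{T})$. The spanning tree polytope $\mathbb{T}(G)\subset[0,1]^E$ is the set of all vectors of edge appearance probabilities arising in this way; equivalently, it is the convex hull of the edge-indicator vectors of the spanning trees of $G$. Pseudomarginals. A vector $\mathbf{T}=\{T_s,\ s\in V\}\cup\{T_{st},\ (s,t)\in E\}$ consists of nonnegative functions $T_s:\mathcal{X}\to[0,\infty)$ and $T_{st}:\mathcal{X}\times\mathcal{X}\to[0,\infty)$,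 and is identified with an element of $\mathbb{R}^{\mathcal{I}}$ via $T_{(s;j)}=T_s(j)$, $T_{(st;jk)}=T_{st}(j,k)$. The constraint set $\mathbb{C}$ consists of all such $\mathbf{T}$ with $\sum_{x_s}T_s(x_s)=1$ for all $s\in V$, and $\sum_{x_t}T_{st}(x_s,x_t)=T_s(x_s)$ and $\sum_{x_s}T_{st}(x_s,x_t)=T_t(x_t)$ for all $(s,t)\in E$ and all $x_s$, $x_t$ in $\mathcal{X}$ respectively. Entropies (convention $0\log 0=0$, natural logarithm). $H_s(T_s)=-\sum_{x_s}T_s(x_s)\log T_s(x_s)$, and $I_{st}(T_{st})=\sum_{x_s,x_t}T_{st}(x_s,x_t)\log\frac{T_{st}(x_s,x_t)}{T_s(x_s)T_t(x_t)}$ is the mutual information of $T_{st}$, where terms with $T_{st}(x_s,x_t)=0$ are taken to be $0$. *)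

(* Defs.v *)
From HB Require Import structures.
From mathcomp Require Import all_boot all_order all_algebra.
From mathcomp Require Import all_classical all_reals all_analysis.
Set Implicit Arguments.
Unset Strict Implicit.
Unset Printing Implicit Defensive.
Import Order.TTheory GRing.Theory Num.Theory.
Local Open Scope classical_set_scope.
Local Open Scope ring_scope.

Definition connected_rel (V : finType) (g : rel V) : Prop :=
  forall s t : V, connect g s t.

(* Simple cycles as vertex sequences: a duplicate-free closed walk [:: s; t]
   merely traverses one edge back and forth, hence the bound 2. *)
Definition acyclic_rel (V : finType) (g : rel V) : Prop :=
  forall c : seq V, cycle g c -> uniq c -> (size c <= 2)%N.

(* E lists each undirected edge of the graph g exactly once, as a pair. *)
Definition orientation (V : finType) (g : rel V) (E : {set V * V}) : Prop :=
  (forall s t, g s t = ((s, t) \in E) || ((t, s) \in E)) /\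
  (forall s t, (s, t) \in E -> (t, s) \notin E).

Definition edge (V : finType) (E : {set V * V}) : finType :=
  {e : V * V | e \in E}.

Definition src (V : finType) (E : {set V * V}) (e : edge E) : V := (val e).1.
Definition tgt (V : finType) (E : {set V * V}) (e : edge E) : V := (val e).2.

Definition edge_rel (V : finType) (E : {set V * V}) (F : {set edge E}) :
    rel V :=
  [rel s t | [exists e in F, (val e == (s, t)) || (val e == (t, s))]].

Definition spanning_tree (V : finType) (E : {set V * V}) (F : {set edge E}) :
    Prop :=
  connected_rel (edge_rel F) /\ acyclic_rel (edge_rel F).

Definition spanning_tree_polytope (R : realType) (V : finType)
    (E : {set V * V}) : set {ffun edge E -> R} :=
  [set mu | exists nu : {set edge E} -> R,
    [/\ forall F, spanning_tree F -> 0 <= nu F,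
        \sum_(F | `[< spanning_tree F >]) nu F = 1 &
        forall e, mu e = \sum_(F | `[< spanning_tree F >] && (e \in F)) nu F]].
Arguments spanning_tree_polytope R {V} E.

(* inl (s, j) is the index (s;j) and inr (e, (j, k)) is (st;jk) for e = (s, t). *)
Definition model_index (V : finType) (E : {set V * V}) (m : nat) : finType :=
  (V * 'I_m + edge E * ('I_m * 'I_m))%type.

Definition potential (R : realType) (V : finType) (E : {set V * V}) (m : nat)
    (a : model_index E m) (x : {ffun V -> 'I_m}) : R :=
  match a with
  | inl (s, j) => (x s == j)%:R
  | inr (e, (j, k)) => ((x (src e) == j) && (x (tgt e) == k))%:R
  end.

Definition log_partition (R : realType) (V : finType) (E : {set V * V})
    (m : nat) (theta : {ffun model_index E m -> R^o}) : R :=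
  ln (\sum_(x : {ffun V -> 'I_m})
        expR (\sum_(a : model_index E m) theta a * potential R a x)).

Definition node_marginal (R : realType) (V : finType) (E : {set V * V}) (m : nat)
    (T : {ffun model_index E m -> R^o}) (s : V) (j : 'I_m) : R :=
  T (inl (s, j)).

Definition edge_marginal (R : realType) (V : finType) (E : {set V * V}) (m : nat)
    (T : {ffun model_index E m -> R^o}) (e : edge E) (j k : 'I_m) : R :=
  T (inr (e, (j, k))).

Definition pseudomarginals (R : realType) (V : finType) (E : {set V * V})
    (m : nat) : set {ffun model_index E m -> R^o} :=
  [set T : {ffun model_index E m -> R^o} |
    [/\ forall a, 0 <= T a,
        forall s, \sum_j node_marginal T s j = 1,
        forall e j, \sum_k edge_marginal T e j k = node_marginal T (src e) j &
        forall e k, \sum_j edge_marginal T e j k = node_marginal T (tgt e) k]].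
Arguments pseudomarginals R {V} E m.

(* In the next two definitions a term with zero leading factor vanishes, ln and
   division being total: this is the convention 0 log 0 = 0. *)
Definition entropy (R : realType) (V : finType) (E : {set V * V}) (m : nat)
    (T : {ffun model_index E m -> R^o}) (s : V) : R :=
  - \sum_(j < m) node_marginal T s j * ln (node_marginal T s j).

Definition mutual_information (R : realType) (V : finType) (E : {set V * V})
    (m : nat) (T : {ffun model_index E m -> R^o}) (e : edge E) : R :=
  \sum_(j < m) \sum_(k < m)
    edge_marginal T e j k *
    ln (edge_marginal T e j k /
        (node_marginal T (src e) j * node_marginal T (tgt e) k)).

Definition free_energy (R : realType) (V : finType) (E : {set V * V}) (m : nat)
    (mu : {ffun edge E -> R}) (theta T : {ffun model_index E m -> R^o}) : R :=
  - (\sum_(s : V) entropy T s)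
  + \sum_(e : edge E) mu e * mutual_information T e
  - \sum_(a : model_index E m) T a * theta a.

Definition is_minimizer (R : realType) (X : Type) (C : set X) (f : X -> R)
    (x : X) : Prop :=
  C x /\ forall y, C y -> f x <= f y.

(* Main.v *)
Require Import Defs.
From HB Require Import structures.
From mathcomp Require Import all_boot all_order all_algebra.
From mathcomp Require Import all_classical all_reals all_analysis.
From mathcomp Require Import ring lra.
Set Implicit Arguments.
Unset Strict Implicit.
Unset Printing Implicit Defensive.
Import Order.TTheory GRing.Theory Num.Theory.
Import numFieldNormedType.Exports.
Local Open Scope classical_set_scope.
Local Open Scope ring_scope.

(* Writing mu as a mixture of spanning trees turns the free energy into a mixture
   of tree free energies minus a linear term. Grow a spanning tree from a root r,
   one leaf at a time: on the local polytope its energy is -H_r plus, for each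
   edge, minus the conditional entropy of the child given the parent, and
   both are sums of terms a ln (a / b), which are jointly convex. Any vertex can
   be the root, so two points with different node marginals are separated
   strictly; with equal node marginals, an edge on which they differ lies in some
   tree of positive weight and separates them. For the bound, evaluate at the true
   marginals of the model p. By Gibbs' inequality, minus the entropy of p is at
   least the cross term of p with the tree-structured density built from these
   marginals, which is the tree energy; averaging over the trees gives the claim.
   Existence is compactness, the free energy agreeing on the polytope with a
   continuous function. *)

(** * The function a ln (a / b) *)

Section KL.
Variable R : realType.
Implicit Types a b c t : R.

(** The perspective of [x ln x], one term of a relative entropy. At [b = 0] total division and [ln]
    make it 0, hence the recurring side condition [b = 0 -> a = 0]. *)
Definition klterm a b : R := a * ln (a / b).

Lemma ln_lt_subr1 a : 0 < a -> a != 1 -> ln a < a - 1.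
Proof.
move=> a0 a1; have /expR_gt1Dx : ln a != 0 by rewrite ln_eq0.
by rewrite lnK ?posrE//; lra.
Qed.

Lemma ln_le_subr1 a : 0 < a -> ln a <= a - 1.
Proof.
move=> a0; have [->|/(ln_lt_subr1 a0)/ltW//] := eqVneq a 1.
by rewrite ln1 subrr.
Qed.

(* Tangent to the convex, 1-homogeneous function [klterm] at the ray [a = b c]. *)
Lemma klterm_tangent a b c : 0 <= a -> 0 <= b -> (b = 0 -> a = 0) -> 0 < c ->
  a * ln c + a - b * c <= klterm a b ?= iff (a == b * c).
Proof.
move=> a_ge0 b_ge0 ba c0; rewrite /klterm.
have [->|a_neq0] := eqVneq a 0.
  rewrite !mul0r add0r sub0r; apply/leifP; rewrite eq_sym mulf_eq0 (gt_eqF c0) orbF.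
  have [->|b_neq0] := eqVneq b 0; first by rewrite mul0r oppr0.
  by rewrite oppr_lt0 mulr_gt0// lt_def b_neq0.
have a0 : 0 < a by rewrite lt_def a_neq0.
have b0 : 0 < b.
  by rewrite lt_def b_ge0 andbT; apply: contra_neq a_neq0.
(* For positive [a] the claim is [ln x <= x - 1] at [x = b * c / a], multiplied by [a]. *)
have x0 : 0 < b * c / a by rewrite divr_gt0 ?mulr_gt0.
have -> : ln (a / b) = ln c - ln (b * c / a).
  by rewrite !ln_div ?lnM ?posrE ?mulr_gt0//; ring.
have e : a - b * c = a * (1 - b * c / a) by field.
rewrite -addrA e -mulrDr; apply/leifP; case: eqVneq => [e1|ne1].
  suff -> : b * c / a = 1 by rewrite ln1 subrr !addr0 subr0.
  by rewrite -e1 divff.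
rewrite ltr_pM2l//.
suff : ln (b * c / a) < b * c / a - 1 by lra.
apply: ln_lt_subr1 => //; apply: contra_neq ne1 => h.
by rewrite -[a]mulr1 -h mulrC divfK.
Qed.

(** Both pairs are compared with the tangent at the common slope [c = (a1 + a2) / (b1 + b2)]. The
    two tangent values add up to the left-hand side, and both are attained exactly when the pairs
    are proportional. *)
Lemma log_sum_ineq a1 b1 a2 b2 : 0 <= a1 -> 0 <= b1 -> 0 <= a2 -> 0 <= b2 ->
  (b1 = 0 -> a1 = 0) -> (b2 = 0 -> a2 = 0) ->
  klterm (a1 + a2) (b1 + b2) <= klterm a1 b1 + klterm a2 b2
    ?= iff (a1 * b2 == a2 * b1).
Proof.
move=> a1_ge0 b1_ge0 a2_ge0 b2_ge0 ba1 ba2.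
have [/eqP|s_neq0] := eqVneq (a1 + a2) 0.
  rewrite paddr_eq0// => /andP[/eqP -> /eqP ->].
  by rewrite /klterm addr0 !mul0r addr0; apply/leifP; rewrite eqxx.
have s0 : 0 < a1 + a2 by rewrite lt_def s_neq0 addr_ge0.
have b0 : 0 < b1 + b2.
  rewrite lt_def addr_ge0// andbT; move: s_neq0; apply: contraNN.
  by rewrite !paddr_eq0// => /andP[/eqP/ba1 -> /eqP/ba2 ->]; rewrite eqxx.
have c0 : 0 < (a1 + a2) / (b1 + b2) by exact: divr_gt0.
have := leifD (klterm_tangent a1_ge0 b1_ge0 ba1 c0)
              (klterm_tangent a2_ge0 b2_ge0 ba2 c0).
set c := (a1 + a2) / (b1 + b2).
have -> : a1 * ln c + a1 - b1 * c + (a2 * ln c + a2 - b2 * c) =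
    klterm (a1 + a2) (b1 + b2).
  rewrite /klterm -/c.
  have -> : b1 * c = a1 + a2 - b2 * c by rewrite /c; field; exact: lt0r_neq0.
  by ring.
suff -> : (a1 == b1 * c) && (a2 == b2 * c) = (a1 * b2 == a2 * b1) by [].
have bn : b1 + b2 != 0 by exact: lt0r_neq0.
apply/andP/eqP => [[/eqP h1 /eqP h2]|h].
  by rewrite h1 h2; ring.
have e1 : b1 * c = a1 by rewrite /c mulrA mulrDr [b1 * a2]mulrC -h; field.
have e2 : b2 * c = a2.
  by rewrite /c mulrA mulrDr [b2 * a1]mulrC h; field.
by rewrite e1 e2 !eqxx.
Qed.

Lemma kltermZ t a b : 0 <= t -> klterm (t * a) (t * b) = t * klterm a b.
Proof.
rewrite /klterm le_eqVlt => /predU1P[<-|t0]; first by rewrite !mul0r.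
by rewrite -mulf_div divff ?gt_eqF// mul1r mulrA.
Qed.

(** By homogeneity the weights [t] and [1 - t] move inside [klterm], where the log-sum inequality
    applies. *)
Lemma klterm_convex t a1 b1 a2 b2 : 0 <= t <= 1 ->
  0 <= a1 -> 0 <= b1 -> 0 <= a2 -> 0 <= b2 ->
  (b1 = 0 -> a1 = 0) -> (b2 = 0 -> a2 = 0) ->
  klterm (t * a1 + (1 - t) * a2) (t * b1 + (1 - t) * b2) <=
    t * klterm a1 b1 + (1 - t) * klterm a2 b2.
Proof.
move=> /andP[t0 t1] a1_ge0 b1_ge0 a2_ge0 b2_ge0 ba1 ba2.
have t1' : 0 <= 1 - t by rewrite subr_ge0.
rewrite -!kltermZ//; apply: log_sum_ineq; rewrite ?mulr_ge0//.
- by move/eqP; rewrite mulf_eq0 => /predU1P[->|/eqP/ba1 ->]; rewrite ?(mul0r, mulr0).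
- by move/eqP; rewrite mulf_eq0 => /predU1P[->|/eqP/ba2 ->]; rewrite ?(mul0r, mulr0).
Qed.

Lemma klterm_strict_convex t a1 b1 a2 b2 : 0 < t < 1 ->
  0 <= a1 -> 0 <= b1 -> 0 <= a2 -> 0 <= b2 ->
  (b1 = 0 -> a1 = 0) -> (b2 = 0 -> a2 = 0) -> a1 * b2 != a2 * b1 ->
  klterm (t * a1 + (1 - t) * a2) (t * b1 + (1 - t) * b2) <
    t * klterm a1 b1 + (1 - t) * klterm a2 b2.
Proof.
move=> /andP[t0 t1] a1_ge0 b1_ge0 a2_ge0 b2_ge0 ba1 ba2 ne.
have t1' : 0 < 1 - t by rewrite subr_gt0.
have t0' := ltW t0; have t1'' := ltW t1'.
rewrite -!kltermZ//.
rewrite (lt_leif (log_sum_ineq _ _ _ _ _ _)) ?mulr_ge0//.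
(* The cross products of the scaled pairs share the nonzero factor [t * (1 - t)], which cancels. *)
- rewrite mulrACA [X in _ == X]mulrACA [(1 - t) * t]mulrC.
  by apply: contra_neq ne; apply: mulfI; rewrite mulf_neq0 ?lt0r_neq0.
- by move/eqP; rewrite mulf_eq0 => /predU1P[->|/eqP/ba1 ->]; rewrite ?(mul0r, mulr0).
- by move/eqP; rewrite mulf_eq0 => /predU1P[->|/eqP/ba2 ->]; rewrite ?(mul0r, mulr0).
Qed.

Lemma klterm1_convex t a1 a2 : 0 <= t <= 1 -> 0 <= a1 -> 0 <= a2 ->
  klterm (t * a1 + (1 - t) * a2) 1 <= t * klterm a1 1 + (1 - t) * klterm a2 1.
Proof.
move=> t01 a1_ge0 a2_ge0.
rewrite [leLHS](_ : _ = klterm (t * a1 + (1 - t) * a2) (t * 1 + (1 - t) * 1)).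
  by apply: klterm_convex => // /eqP; rewrite oner_eq0.
by congr klterm; ring.
Qed.

Lemma klterm1_strict_convex t a1 a2 : 0 < t < 1 -> 0 <= a1 -> 0 <= a2 ->
  a1 != a2 ->
  klterm (t * a1 + (1 - t) * a2) 1 < t * klterm a1 1 + (1 - t) * klterm a2 1.
Proof.
move=> t01 a1_ge0 a2_ge0 ne.
rewrite [ltLHS](_ : _ = klterm (t * a1 + (1 - t) * a2) (t * 1 + (1 - t) * 1)).
  by apply: klterm_strict_convex; rewrite ?mulr1// => /eqP; rewrite oner_eq0.
by congr klterm; ring.
Qed.

Lemma xlnx_continuous : continuous (fun x : R => x * ln x).
Proof.
move=> x; have [x0|x0|->] := ltgtP x 0.
- rewrite /continuous_at ln0 ?mulr0 ?ltW//; apply: cvg_near_cst.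
  by near=> y; rewrite ln0 ?mulr0// ltW//; near: y; exact: lt_nbhsl.
- by apply: continuousM; [exact: cvg_id|exact: continuous_ln].
rewrite /continuous_at mul0r; apply/cvgr0Pnorm_lt => e e0.
(* This radius gives [sqrt y < e / 2], so that the bound [2 sqrt y] obtained below is less than
   [e]. *)
have h2 : 0 < (e / 2) ^+ 2 by rewrite exprn_gt0// divr_gt0.
near=> y.
have [y0|y0] := leP y 0; first by rewrite ln0// mulr0 normr0.
have y1 : y < 1 by near: y; exact: lt_nbhsl.
have sy : 0 < Num.sqrt y by rewrite sqrtr_gt0.
have ye : Num.sqrt y < e / 2.
  rewrite -[e / 2]ger0_norm ?divr_ge0 ?ltW// -sqrtr_sqr ltr_sqrt//.
  by near: y; exact: lt_nbhsl.
(* |y ln y| = 2 y ln (1 / sqrt y) < 2 sqrt y *)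
have := ln_sublinear (x := (Num.sqrt y)^-1); rewrite invr_gt0 => /(_ sy).
rewrite lnV ?posrE// => h.
have ly : ln y = 2 * ln (Num.sqrt y).
  by rewrite -{1}(sqr_sqrtr (ltW y0)) lnXn// mulr_natl.
rewrite ler0_norm; last by rewrite nmulr_lle0 ?ltW// ln_lt0// y0.
rewrite ly -{1}(sqr_sqrtr (ltW y0)).
have : Num.sqrt y * (- ln (Num.sqrt y)) < 1.
  by rewrite -(divff (lt0r_neq0 sy)) ltr_pM2l.
nra.
Unshelve. all: by end_near. Qed.

End KL.

(** * Growing a spanning tree from a root *)

Section Trees.
Variables (V : finType) (E : {set V * V}).
Implicit Types (S : {set V}) (F : {set edge E}) (e : edge E).

(** A rooted tree is recorded by its construction: [S] holds the vertices reached and [F] the edges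
    used. There are two growth steps because the new leaf may be either end of the oriented edge. *)
Inductive rooted (r : V) : {set V} -> {set edge E} -> Prop :=
| rooted1 : rooted r [set r] finset.set0
| rooted_tgt S F e : rooted r S F -> src e \in S -> tgt e \notin S ->
    rooted r (tgt e |: S) (e |: F)
| rooted_src S F e : rooted r S F -> tgt e \in S -> src e \notin S ->
    rooted r (src e |: S) (e |: F).

Lemma edge_relP F s t :
  reflect (exists2 e, e \in F & (src e, tgt e) = (s, t) \/ (src e, tgt e) = (t, s))
    (edge_rel F s t).
Proof.
rewrite /edge_rel /=; apply: (iffP exists_inP) => -[e eF h]; exists e => //.
  by case/orP: h => /eqP h; [left|right]; rewrite -h /src /tgt -surjective_pairing.
by rewrite /src /tgt -!surjective_pairing in h; case: h => ->; rewrite eqxx ?orbT.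
Qed.

Lemma edge_rel_sym F : symmetric (edge_rel F).
Proof. by move=> s t; apply/edge_relP/edge_relP => -[e eF [] h]; exists e; auto. Qed.

Lemma edge_rel_edge F e : e \in F -> edge_rel F (src e) (tgt e).
Proof. by move=> eF; apply/edge_relP; exists e; auto. Qed.

Lemma sub_edge_rel F F' : F \subset F' -> subrel (edge_rel F) (edge_rel F').
Proof.
move=> /fintype.subsetP sF s t /edge_relP[e /sF eF h]; apply/edge_relP; by exists e.
Qed.

Lemma rooted_edges r S F e : rooted r S F -> e \in F -> (src e \in S) && (tgt e \in S).
Proof.
elim=> {S F} [|S F e' _ IH h1 h2|S F e' _ IH h1 h2]; first by rewrite finset.in_set0.
- by rewrite !inE => /predU1P[->|/IH /andP[eS1 eS2]]; rewrite ?h1 ?eS1 ?eS2 ?eqxx ?orbT.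
- by rewrite !inE => /predU1P[->|/IH /andP[eS1 eS2]]; rewrite ?h1 ?eS1 ?eS2 ?eqxx ?orbT.
Qed.

Lemma rooted_root r S F : rooted r S F -> r \in S.
Proof. by elim=> {S F} [|S F e _ h _ _|S F e _ h _ _]; rewrite !inE ?h ?orbT. Qed.

Lemma rooted_connect r S F s : rooted r S F -> s \in S -> connect (edge_rel F) r s.
Proof.
move=> h; elim: h s => {S F} [s|S F e _ IH h1 h2 s|S F e _ IH h1 h2 s].
- by rewrite inE => /eqP ->; exact: connect0.
- have sub : subrel (connect (edge_rel F)) (connect (edge_rel (e |: F))).
    apply: connect_sub => u v uv; apply: connect1.
    by apply: sub_edge_rel uv; exact: finset.subsetUr.
  rewrite !inE => /predU1P[->|/IH/sub//].
  apply: connect_trans (sub _ _ (IH _ h1)) (connect1 _).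
  by apply: edge_rel_edge; rewrite !inE eqxx.
- have sub : subrel (connect (edge_rel F)) (connect (edge_rel (e |: F))).
    apply: connect_sub => u v uv; apply: connect1.
    by apply: sub_edge_rel uv; exact: finset.subsetUr.
  rewrite !inE => /predU1P[->|/IH/sub//].
  apply: connect_trans (sub _ _ (IH _ h1)) (connect1 _).
  by rewrite edge_rel_sym; apply: edge_rel_edge; rewrite !inE eqxx.
Qed.

Lemma connect_crossing (g : rel V) S s t :
  connect g s t -> s \in S -> t \notin S ->
  exists u v, [/\ g u v, u \in S & v \notin S].
Proof.
move=> /connectP[p]; elim: p s => [s _ -> -> //|v p IH s /= /andP[sv vp] tE sS tS].
have [vS|vS] := boolP (v \in S); first exact: (IH v).
by exists s, v.
Qed.

(** Greedy growth, by induction on the number of unreached vertices: while one remains, connectivity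
    provides an edge of [F0] leaving [S]. *)
Lemma rooted_extend r S F F0 : connected_rel (edge_rel F0) ->
  rooted r S F -> F \subset F0 ->
  exists2 F', rooted r [set: V] F' & F' \subset F0.
Proof.
move=> F0_conn; have [n] := ubnP #|~: S|.
elim: n S F => // n IH S F /ltnSE Sn h sF.
have [/eqP S_T|] := boolP (S == [set: V]%SET); first by exists F => //; rewrite -S_T.
rewrite -finset.subTset => /subsetPn[t _ tS].
have [u [v [uv uS vS]]] := connect_crossing (F0_conn r t) (rooted_root h) tS.
have lt : (#|~: (v |: S)| < n)%N.
  apply: leq_trans Sn; apply: proper_card; apply/properP; split.
    by rewrite finset.setCS finset.subsetUr.
  by exists v; rewrite !inE ?eqxx ?vS.
have /edge_relP[e eF0 [] [] he1 he2] := uv; subst u v.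
  by apply: IH lt (rooted_tgt h uS vS) _; rewrite finset.subUset finset.sub1set eF0.
by apply: IH lt (rooted_src h uS vS) _; rewrite finset.subUset finset.sub1set eF0.
Qed.

(** * Spanning trees of an oriented simple graph *)

Variables (g : rel V).
Hypotheses (g_irr : irreflexive g) (gE : orientation g E).

Lemma src_neq_tgt e : src e != tgt e.
Proof.
apply/eqP => h; have := valP e; rewrite (surjective_pairing (val e)) -/(src e) -/(tgt e) h => h'.
by have := gE.1 (tgt e) (tgt e); rewrite h' g_irr.
Qed.

Lemma orientation_edge_inj e e' :
  (src e', tgt e') = (src e, tgt e) \/ (src e', tgt e') = (tgt e, src e) -> e = e'.
Proof.
move=> h; have := valP e; have := valP e'.
rewrite (surjective_pairing (val e)) (surjective_pairing (val e')).
case: h => -[]; rewrite /src /tgt => h1 h2 h3 h4.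
  by apply: val_inj; rewrite (surjective_pairing (val e)) -h1 -h2 -surjective_pairing.
by move: h3; rewrite h1 h2 (negbTE (gE.2 _ _ h4)).
Qed.

(** Connectedness yields a rooted tree [F'] inside [F] reaching all vertices. An edge of [F] outside
    [F'] would close a cycle with a path of [F'], so acyclicity forces [F = F']. *)
Lemma spanning_tree_rooted r F : spanning_tree F -> rooted r [set: V] F.
Proof.
move=> [F_conn F_acyc].
have [F' hF' sF] := rooted_extend F_conn (rooted1 r) (finset.sub0set F).
suff -> : F = F' by [].
apply/eqP; rewrite eq_sym finset.eqEsubset sF; apply/fintype.subsetP => e eF.
apply: contraT => eF'.
have : connect (edge_rel F') (src e) (tgt e).
  apply: connect_trans (rooted_connect hF' (finset.in_setT _)).
  rewrite (sym_connect_sym (@edge_rel_sym F')).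
  exact: rooted_connect hF' (finset.in_setT _).
(* A shortest path from [src e] to [tgt e] avoiding [e] closes up to a long cycle. *)
case/connectP => p0 p0F lastp0.
case/shortenP: p0F lastp0 => p pF p_uniq _ lastp {p0}.
(* An empty path would make [e] a loop, and a single edge would put [e] in [F']; a longer path
   closes to a cycle on at least three vertices. *)
case: p => [|v [|w p]] in pF p_uniq lastp.
- by have := src_neq_tgt e; rewrite lastp /= eqxx.
- move: pF lastp; rewrite /= andbT => /edge_relP[e' e'F' h] v_e; move: h; rewrite -v_e.
  by move/orientation_edge_inj => ee'; rewrite ee' e'F' in eF'.
have /F_acyc : cycle (edge_rel F) (src e :: v :: w :: p).
  rewrite (cycle_path (src e)) [last _ _]/= -[last w p]/(last (src e) [:: v, w & p]) -lastp.
  rewrite [path _ _ _]/= edge_rel_sym edge_rel_edge//=.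
  by apply: sub_path pF; exact: sub_edge_rel.
by move=> /(_ p_uniq).
Qed.

End Trees.

(** * Energy of a tree *)

Section Energy.
Variables (R : realType) (V : finType) (E : {set V * V}) (m : nat).
Local Notation point := {ffun model_index E m -> R^o}.
Local Notation C := (pseudomarginals R E m).
Implicit Types (T : point) (e : edge E) (S : {set V}) (F : {set edge E}).

Lemma node_marginal_ge0 T s j : C T -> 0 <= node_marginal T s j.
Proof. by case=> T0 _ _ _; exact: T0. Qed.

Lemma edge_marginal_ge0 T e j k : C T -> 0 <= edge_marginal T e j k.
Proof. by case=> T0 _ _ _; exact: T0. Qed.

Lemma edge_marginal_le_src T e j k : C T ->
  edge_marginal T e j k <= node_marginal T (src e) j.
Proof.
move=> CT; have [_ _ <- _] := CT.
by rewrite (bigD1 k)//= lerDl sumr_ge0// => i _; exact: edge_marginal_ge0.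
Qed.

Lemma edge_marginal_le_tgt T e j k : C T ->
  edge_marginal T e j k <= node_marginal T (tgt e) k.
Proof.
move=> CT; have [_ _ _ <-] := CT.
by rewrite (bigD1 j)//= lerDl sumr_ge0// => i _; exact: edge_marginal_ge0.
Qed.

(** The flag [b] lets both directions of an edge share one treatment; only the state at the parent
    end is read. *)
Definition parent_marginal (b : bool) T e (j k : 'I_m) : R :=
  if b then node_marginal T (src e) j else node_marginal T (tgt e) k.

Lemma edge_marginal_le_parent b T e j k : C T ->
  edge_marginal T e j k <= parent_marginal b T e j k.
Proof.
by case: b => CT; [exact: edge_marginal_le_src|exact: edge_marginal_le_tgt].
Qed.

Lemma parent_marginal_ge0 b T e j k : C T -> 0 <= parent_marginal b T e j k.
Proof. by case: b => CT; exact: node_marginal_ge0. Qed.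

(** Supplies the side condition of the [klterm] lemmas. *)
Lemma parent_marginal_eq0 b T e j k : C T ->
  parent_marginal b T e j k = 0 -> edge_marginal T e j k = 0.
Proof.
move=> CT h; apply/eqP; rewrite eq_le edge_marginal_ge0// andbT -h.
exact: edge_marginal_le_parent.
Qed.

(* Minus the conditional entropy of the child end of [e] given its parent end;
   the parent is [src e] when [b] holds and [tgt e] otherwise. *)
Definition neg_cond_entropy (b : bool) T e : R :=
  \sum_(j < m) \sum_(k < m)
    klterm (edge_marginal T e j k) (parent_marginal b T e j k).

(** The chain rule: mutual information is the entropy of the child minus its conditional entropy
    given the parent. Expanding the child marginal as a sum of edge marginals makes the identity
    hold term by term. *)
Lemma mutual_information_tgt T e : C T ->
  mutual_information T e = neg_cond_entropy true T e + entropy T (tgt e).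
Proof.
move=> CT; rewrite /mutual_information /neg_cond_entropy /entropy.
have [_ _ _ Et] := CT.
under [X in _ + - X]eq_bigr do rewrite -[X in X * _]Et mulr_suml.
rewrite [X in _ = _ - X]exchange_big -sumrB; apply: eq_bigr => j _.
rewrite -sumrB; apply: eq_bigr => k _; rewrite /klterm /=.
have [->|Te] := eqVneq (edge_marginal T e j k) 0; first by rewrite !mul0r subrr.
have Te0 : 0 < edge_marginal T e j k by rewrite lt_def Te edge_marginal_ge0.
have Ts0 := lt_le_trans Te0 (edge_marginal_le_src e j k CT).
have Tt0 := lt_le_trans Te0 (edge_marginal_le_tgt e j k CT).
by rewrite !ln_div ?lnM ?posrE ?mulr_gt0//; ring.
Qed.

Lemma mutual_information_src T e : C T ->
  mutual_information T e = neg_cond_entropy false T e + entropy T (src e).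
Proof.
move=> CT; rewrite /mutual_information /neg_cond_entropy /entropy.
have [_ _ Es _] := CT.
under [X in _ + - X]eq_bigr do rewrite -[X in X * _]Es mulr_suml.
rewrite -sumrB; apply: eq_bigr => j _.
rewrite -sumrB; apply: eq_bigr => k _; rewrite /klterm /=.
have [->|Te] := eqVneq (edge_marginal T e j k) 0; first by rewrite !mul0r subrr.
have Te0 : 0 < edge_marginal T e j k by rewrite lt_def Te edge_marginal_ge0.
have Ts0 := lt_le_trans Te0 (edge_marginal_le_src e j k CT).
have Tt0 := lt_le_trans Te0 (edge_marginal_le_tgt e j k CT).
by rewrite !ln_div ?lnM ?posrE ?mulr_gt0//; ring.
Qed.

(** Minus the Bethe entropy. It is defined for partial trees so that it can be computed leaf by
    leaf. *)
Definition tree_energy S F T : R :=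
  - (\sum_(s in S) entropy T s) + \sum_(e in F) mutual_information T e.

(** Each new leaf adds its negative entropy and the mutual information of its edge, which the chain
    rule merges into one conditional term. The directions [par] depend on the tree alone, so two
    points and their mixture share them. *)
Lemma rooted_tree_energy r S F : rooted r S F ->
  exists par : edge E -> bool, forall T, C T ->
    tree_energy S F T = - entropy T r + \sum_(e in F) neg_cond_entropy (par e) T e.
Proof.
move=> h; elim: h => {S F} [|S F e h [par IH] eS eS'|S F e h [par IH] eS eS'].
- exists xpredT => T CT.
  by rewrite /tree_energy big_set1 !big_set0.
- have eF : e \notin F by apply: contra eS' => /(rooted_edges h)/andP[].
  exists (fun e' => if e' == e then true else par e') => T CT.
  rewrite /tree_energy !big_setU1//= eqxx mutual_information_tgt//.
  rewrite [X in _ = _ + (_ + X)](eq_bigr (fun e' => neg_cond_entropy (par e') T e')).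
    by have := IH _ CT; rewrite /tree_energy; lra.
  by move=> e' e'F; case: eqVneq e'F => // ->; rewrite (negbTE eF).
- have eF : e \notin F by apply: contra eS' => /(rooted_edges h)/andP[].
  exists (fun e' => if e' == e then false else par e') => T CT.
  rewrite /tree_energy !big_setU1//= eqxx mutual_information_src//.
  rewrite [X in _ = _ + (_ + X)](eq_bigr (fun e' => neg_cond_entropy (par e') T e')).
    by have := IH _ CT; rewrite /tree_energy; lra.
  by move=> e' e'F; case: eqVneq e'F => // ->; rewrite (negbTE eF).
Qed.

(** * Convex combinations of pseudomarginals *)

Definition mix (t : R) T T' : point := t *: T + (1 - t) *: T'.

Lemma mixE t T T' a : mix t T T' a = t * T a + (1 - t) * T' a.
Proof. by rewrite /mix !ffunE. Qed.

Lemma node_marginal_mix t T T' s j : node_marginal (mix t T T') s j =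
  t * node_marginal T s j + (1 - t) * node_marginal T' s j.
Proof. exact: mixE. Qed.

Lemma edge_marginal_mix t T T' e j k : edge_marginal (mix t T T') e j k =
  t * edge_marginal T e j k + (1 - t) * edge_marginal T' e j k.
Proof. exact: mixE. Qed.

Lemma parent_marginal_mix b t T T' e j k : parent_marginal b (mix t T T') e j k =
  t * parent_marginal b T e j k + (1 - t) * parent_marginal b T' e j k.
Proof. by case: b; exact: mixE. Qed.

Lemma pseudomarginals_mix t T T' : 0 <= t <= 1 -> C T -> C T' -> C (mix t T T').
Proof.
move=> /andP[t0 t1] [T0 T1 Ts Tt] [T'0 T'1 T's T't]; split.
- by move=> a; rewrite mixE addr_ge0 ?mulr_ge0 ?subr_ge0.
- move=> s; under eq_bigr do rewrite node_marginal_mix.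
  by rewrite big_split /= -!mulr_sumr T1 T'1; ring.
- move=> e j; under eq_bigr do rewrite edge_marginal_mix.
  by rewrite big_split /= -!mulr_sumr Ts T's node_marginal_mix.
- move=> e k; under eq_bigr do rewrite edge_marginal_mix.
  by rewrite big_split /= -!mulr_sumr Tt T't node_marginal_mix.
Qed.

Lemma entropyE T s : - entropy T s = \sum_j klterm (node_marginal T s j) 1.
Proof. by rewrite /entropy opprK; apply: eq_bigr => j _; rewrite /klterm divr1. Qed.

Lemma neg_entropy_convex t T T' s : 0 <= t <= 1 -> C T -> C T' ->
  - entropy (mix t T T') s <= t * - entropy T s + (1 - t) * - entropy T' s.
Proof.
move=> t01 CT CT'; rewrite !entropyE !mulr_sumr -big_split; apply: ler_sum => j _.
by rewrite node_marginal_mix klterm1_convex ?node_marginal_ge0.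
Qed.

Lemma neg_entropy_strict_convex t T T' s j : 0 < t < 1 -> C T -> C T' ->
  node_marginal T s j != node_marginal T' s j ->
  - entropy (mix t T T') s < t * - entropy T s + (1 - t) * - entropy T' s.
Proof.
move=> t01 CT CT' ne; have /andP[t0 t1] := t01.
rewrite !entropyE !mulr_sumr -big_split (bigD1 j)//= [ltRHS](bigD1 j)//=.
apply: ltr_leD; last apply: ler_sum => i _; rewrite node_marginal_mix.
  by rewrite klterm1_strict_convex ?node_marginal_ge0.
by rewrite klterm1_convex ?node_marginal_ge0 ?ltW.
Qed.

Lemma neg_cond_entropy_convex b t T T' e : 0 <= t <= 1 -> C T -> C T' ->
  neg_cond_entropy b (mix t T T') e <=
    t * neg_cond_entropy b T e + (1 - t) * neg_cond_entropy b T' e.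
Proof.
move=> t01 CT CT'; rewrite !mulr_sumr -big_split; apply: ler_sum => j _ /=.
rewrite !mulr_sumr -big_split; apply: ler_sum => k _ /=.
rewrite edge_marginal_mix parent_marginal_mix.
by apply: klterm_convex; rewrite ?edge_marginal_ge0 ?parent_marginal_ge0//;
  exact: parent_marginal_eq0.
Qed.

Lemma neg_cond_entropy_strict_convex b t T T' e j k : 0 < t < 1 -> C T -> C T' ->
  (forall s i, node_marginal T s i = node_marginal T' s i) ->
  edge_marginal T e j k != edge_marginal T' e j k ->
  neg_cond_entropy b (mix t T T') e <
    t * neg_cond_entropy b T e + (1 - t) * neg_cond_entropy b T' e.
Proof.
move=> t01 CT CT' eqn ne; have /andP[t0 t1] := t01.
have eqp i l : parent_marginal b T e i l = parent_marginal b T' e i l.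
  by rewrite /parent_marginal; case: (b).
have le i l : klterm (edge_marginal (mix t T T') e i l) (parent_marginal b (mix t T T') e i l) <=
    t * klterm (edge_marginal T e i l) (parent_marginal b T e i l) +
    (1 - t) * klterm (edge_marginal T' e i l) (parent_marginal b T' e i l).
  rewrite edge_marginal_mix parent_marginal_mix.
  by apply: klterm_convex; rewrite ?edge_marginal_ge0 ?parent_marginal_ge0 ?ltW//;
    exact: parent_marginal_eq0.
rewrite /neg_cond_entropy !pair_bigA /= !mulr_sumr -big_split (bigD1 (j, k))//=.
rewrite [ltRHS](bigD1 (j, k))//=; apply: ltr_leD; last by apply: ler_sum => -[i l] _ /=.
rewrite edge_marginal_mix parent_marginal_mix.
apply: klterm_strict_convex; rewrite ?edge_marginal_ge0 ?parent_marginal_ge0//;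
  try exact: parent_marginal_eq0.
(* The parent marginals coincide, so proportionality cancels to equality of the edge marginals; if
   the parent marginal is 0, both edge marginals vanish. *)
rewrite eqp; apply: contra_neq (ne); apply: mulIf.
apply/eqP => p0; move/eqP: ne; apply.
by rewrite !(@parent_marginal_eq0 b)// eqp.
Qed.

End Energy.

(** * Strict convexity *)

Section FreeEnergy.
Variables (R : realType) (V : finType) (g : rel V) (E : {set V * V}) (m : nat).
Hypotheses (g_irr : irreflexive g) (gE : orientation g E).
Local Notation point := {ffun model_index E m -> R^o}.
Local Notation C := (pseudomarginals R E m).
Implicit Types (T : point) (e : edge E) (F : {set edge E}).


Lemma tree_energy_convex t F T T' : spanning_tree F -> 0 <= t <= 1 -> C T -> C T' ->
  tree_energy [set: V] F (mix t T T') <=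
    t * tree_energy [set: V] F T + (1 - t) * tree_energy [set: V] F T'.
Proof.
move=> F_tree t01 CT CT'; case: (pickP V) => [r _|V0]; last first.
  have pt_eq (U U' : point) : U = U'.
    by apply/ffunP => -[[s j]|[e jk]]; [have := V0 s|have := V0 (src e)].
  rewrite (pt_eq (mix t T T') T) (pt_eq T' T) -mulrDl.
  by rewrite (_ : t + (1 - t) = 1) ?mul1r//; ring.
have [par treeE] := rooted_tree_energy R m (spanning_tree_rooted g_irr gE r F_tree).
rewrite !treeE//; last exact: pseudomarginals_mix.
rewrite !mulrDr !mulr_sumr addrACA -big_split; apply: lerD.
  exact: neg_entropy_convex.
by apply: ler_sum => e _; exact: neg_cond_entropy_convex.
Qed.

(** Rooting the tree at [s] exposes the entropy of [s], which is where strictness comes from. *)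
Lemma tree_energy_strict_node t F T T' s j :
  spanning_tree F -> 0 < t < 1 -> C T -> C T' ->
  node_marginal T s j != node_marginal T' s j ->
  tree_energy [set: V] F (mix t T T') <
    t * tree_energy [set: V] F T + (1 - t) * tree_energy [set: V] F T'.
Proof.
move=> F_tree t01 CT CT' ne; have /andP[t0 t1] := t01.
have [par treeE] := rooted_tree_energy R m (spanning_tree_rooted g_irr gE s F_tree).
rewrite !treeE//; last by apply: pseudomarginals_mix; rewrite ?ltW.
rewrite !mulrDr !mulr_sumr addrACA -big_split; apply: ltr_leD.
  exact: neg_entropy_strict_convex ne.
by apply: ler_sum => e _; apply: neg_cond_entropy_convex; rewrite ?ltW.
Qed.

(** Strictness comes from the conditional term of [e], whichever end is the parent; [src e] merely
    serves as some root. *)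
Lemma tree_energy_strict_edge t F T T' e j k :
  spanning_tree F -> 0 < t < 1 -> C T -> C T' -> e \in F ->
  (forall s i, node_marginal T s i = node_marginal T' s i) ->
  edge_marginal T e j k != edge_marginal T' e j k ->
  tree_energy [set: V] F (mix t T T') <
    t * tree_energy [set: V] F T + (1 - t) * tree_energy [set: V] F T'.
Proof.
move=> F_tree t01 CT CT' eF eqn ne; have /andP[t0 t1] := t01.
have [par treeE] :=
  rooted_tree_energy R m (spanning_tree_rooted g_irr gE (src e) F_tree).
rewrite !treeE//; last by apply: pseudomarginals_mix; rewrite ?ltW.
rewrite !mulrDr !mulr_sumr addrACA -big_split; apply: ler_ltD.
  by apply: neg_entropy_convex; rewrite ?ltW.
rewrite (bigD1 e)//= [ltRHS](bigD1 e)//=; apply: ltr_leD.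
  exact: neg_cond_entropy_strict_convex ne.
by apply: ler_sum => e' _; apply: neg_cond_entropy_convex; rewrite ?ltW.
Qed.

(** * The free energy as a mixture of trees *)

Variables (theta : point) (mu : {ffun edge E -> R}) (nu : {set edge E} -> R).
Hypothesis nu_ge0 : forall F, spanning_tree F -> 0 <= nu F.
Hypothesis nu_sum1 : \sum_(F | `[< spanning_tree F >]) nu F = 1.
Hypothesis muE :
  forall e, mu e = \sum_(F | `[< spanning_tree F >] && (e \in F)) nu F.

(** The total weight 1 distributes the node entropies over the trees; exchanging the sums over edges
    and trees distributes the edge terms. *)
Lemma free_energy_trees T : free_energy mu theta T =
  \sum_(F | `[< spanning_tree F >]) nu F * tree_energy [set: V] F T
  - \sum_a T a * theta a.
Proof.
rewrite /free_energy /tree_energy; congr (_ - _).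
under [RHS]eq_bigr do rewrite mulrDr; rewrite big_split /= -mulr_suml nu_sum1 mul1r.
congr (- _ + _); first by apply: eq_bigl => s; rewrite finset.in_setT.
under eq_bigr do rewrite muE mulr_suml.
rewrite (exchange_big_dep (fun F => `[< spanning_tree F >]))/=; last by move=> e F _ /andP[].
apply: eq_bigr => F F_tree; rewrite mulr_sumr; apply: eq_bigl => e.
by rewrite F_tree.
Qed.

Lemma linear_term_mix t T T' : \sum_a mix t T T' a * theta a =
  t * \sum_a T a * theta a + (1 - t) * \sum_a T' a * theta a.
Proof.
by rewrite !mulr_sumr -big_split; apply: eq_bigr => a _; rewrite mixE /=; ring.
Qed.

Lemma free_energy_convex t T T' : 0 <= t <= 1 -> C T -> C T' ->
  free_energy mu theta (mix t T T') <=
    t * free_energy mu theta T + (1 - t) * free_energy mu theta T'.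
Proof.
move=> t01 CT CT'; rewrite !free_energy_trees linear_term_mix !mulrBr addrACA -opprD.
rewrite lerD2r !mulr_sumr -big_split; apply: ler_sum => F /asboolP F_tree /=.
rewrite !(mulrCA _ (nu F)) -mulrDr ler_wpM2l ?nu_ge0//.
exact: tree_energy_convex.
Qed.

Lemma free_energy_strict_tree t F T T' : spanning_tree F -> 0 < nu F ->
  0 < t < 1 -> C T -> C T' ->
  tree_energy [set: V] F (mix t T T') <
    t * tree_energy [set: V] F T + (1 - t) * tree_energy [set: V] F T' ->
  free_energy mu theta (mix t T T') <
    t * free_energy mu theta T + (1 - t) * free_energy mu theta T'.
Proof.
move=> F_tree nuF t01 CT CT' ltF; have /andP[t0 t1] := t01.
rewrite !free_energy_trees linear_term_mix !mulrBr addrACA -opprD.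
have pF : `[< spanning_tree F >] by exact/asboolP.
rewrite ltrD2r !mulr_sumr -big_split (bigD1 F)//= [ltRHS](bigD1 F)//=.
apply: ltr_leD.
  by rewrite !(mulrCA _ (nu F)) -mulrDr ltr_pM2l.
apply: ler_sum => F' /andP[/asboolP F'_tree _].
rewrite !(mulrCA _ (nu F')) -mulrDr ler_wpM2l ?nu_ge0//.
by apply: tree_energy_convex; rewrite ?ltW.
Qed.

Lemma exists_tree_gt0 (P : pred {set edge E}) :
  0 < \sum_(F | `[< spanning_tree F >] && P F) nu F ->
  exists F, [/\ spanning_tree F, P F & 0 < nu F].
Proof.
move=> /lt0r_neq0; apply: contra_neqP => nF.
apply: big1 => F /andP[/asboolP F_tree PF]; apply/eqP; rewrite eq_le nu_ge0// andbT.
by rewrite leNgt; apply/negP => nuF; apply: nF; exists F.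
Qed.

Hypothesis mu_gt0 : forall e, 0 < mu e.

Lemma free_energy_strict_convex t T T' : 0 < t < 1 -> C T -> C T' -> T != T' ->
  free_energy mu theta (mix t T T') <
    t * free_energy mu theta T + (1 - t) * free_energy mu theta T'.
Proof.
move=> t01 CT CT' neT.
have [eqn|] := pselect (forall s i, node_marginal T s i = node_marginal T' s i).
  have [e [j [k ne]]] : exists e j k, edge_marginal T e j k != edge_marginal T' e j k.
    apply: contra_neqP neT => h; apply/ffunP => -[[s j]|[e [j k]]]; first exact: eqn.
    by apply/eqP; apply: contra_notT h => ne; exists e, j, k.
  have := mu_gt0 e; rewrite muE => /exists_tree_gt0[F [F_tree eF nuF]].
  apply: (free_energy_strict_tree F_tree) => //.
  exact: tree_energy_strict_edge ne.
move=> /existsNP[s /existsNP[j /eqP ne]].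
(* Any tree of positive weight will do here, since it can be rooted at [s]. *)
have [|F [F_tree _ nuF]] := @exists_tree_gt0 xpredT.
  by under eq_bigl do rewrite andbT; rewrite nu_sum1.
apply: (free_energy_strict_tree F_tree) => //.
exact: tree_energy_strict_node ne.
Qed.

(** The midpoint of two distinct minimizers would have a strictly smaller value. *)
Lemma free_energy_minimizer_unique T T' :
  is_minimizer C (free_energy mu theta) T ->
  is_minimizer C (free_energy mu theta) T' -> T = T'.
Proof.
move=> [CT minT] [CT' minT']; apply/eqP; apply: contraT => neT.
have t01 : 0 < (2^-1 : R) < 1 by lra.
have /andP[t0 t1] := t01.
have := free_energy_strict_convex t01 CT CT' neT.
have Cmix : C (mix 2^-1 T T') by apply: pseudomarginals_mix; rewrite ?ltW.
have := minT _ Cmix; have := minT' _ Cmix; lra.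
Qed.

End FreeEnergy.

(** * Upper bound on the log partition function *)

Lemma ln_prod (R : realType) (I : finType) (P : pred I) (f : I -> R) :
  (forall i, P i -> 0 < f i) -> ln (\prod_(i | P i) f i) = \sum_(i | P i) ln (f i).
Proof.
(* Positivity of the partial products is carried through the induction, as splitting the logarithm
   requires it. *)
move=> f0; apply: (@proj1 _ (0 < \prod_(i | P i) f i)).
elim/big_rec2: _ => [|i y1 y2 Pi [<- y0]]; first by rewrite ln1.
by rewrite lnM ?posrE ?mulr_gt0 ?f0.
Qed.

(** Termwise this is [ln u <= u - 1] at [u = q x / p x], weighted by [p x]. *)
Lemma gibbs_ineq (R : realType) (X : finType) (p q : X -> R) :
  (forall x, 0 < p x) -> (forall x, 0 < q x) ->
  \sum_x p x = 1 -> \sum_x q x <= 1 ->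
  \sum_x p x * ln (q x) <= \sum_x p x * ln (p x).
Proof.
move=> p0 q0 p1 q1; rewrite -subr_le0 -sumrB.
apply: (@le_trans _ _ (\sum_x (q x - p x))); last by rewrite sumrB p1 subr_le0.
apply: ler_sum => x _; rewrite -mulrBr -ln_div ?posrE//.
have e : q x - p x = p x * (q x / p x - 1).
  by field; rewrite gt_eqF.
by rewrite e ler_pM2l// ln_le_subr1// divr_gt0.
Qed.

(** * Resampling one coordinate *)

Section Resample.
Variables (R : realType) (V : finType) (m : nat).
Implicit Types (x : {ffun V -> 'I_m}).

Definition upd x (v : V) (j : 'I_m) : {ffun V -> 'I_m} :=
  [ffun u => if u == v then j else x u].

Lemma upd_same x v j : upd x v j v = j.
Proof. by rewrite ffunE eqxx. Qed.

Lemma upd_neq x v j u : u != v -> upd x v j u = x u.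
Proof. by rewrite ffunE => /negbTE ->. Qed.

Lemma sum_upd (f : {ffun V -> 'I_m} -> R) v :
  \sum_x \sum_j f (upd x v j) = m%:R * \sum_x f x.
Proof.
(* [h] swaps the coordinate at [v] with the stored state, so reindexing by it turns [upd x v j] back
   into a free configuration. *)
pose h (y : {ffun V -> 'I_m} * 'I_m) := (upd y.1 v y.2, y.1 v).
have hK : involutive h.
  move=> [x j]; rewrite /h /= upd_same; congr (_, _).
  by apply/ffunP => u; rewrite !ffunE; case: eqVneq => // ->.
rewrite pair_bigA (reindex_inj (inv_inj hK)) /=.
transitivity (\sum_x \sum_(j < m) f x).
  rewrite pair_bigA; apply: eq_bigr => y _ /=.
  by have /(congr1 fst) /= := hK y => ->.
by rewrite mulr_sumr; apply: eq_bigr => x _; rewrite sumr_const card_ord mulr_natl.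
Qed.

End Resample.

(** * Tree-structured densities *)

Section TreeDensity.
Variables (R : realType) (V : finType) (g : rel V) (E : {set V * V}) (m : nat).
Hypotheses (g_irr : irreflexive g) (gE : orientation g E).
Local Notation point := {ffun model_index E m -> R^o}.
Local Notation C := (pseudomarginals R E m).
Implicit Types (T : point) (e : edge E) (S : {set V}) (F : {set edge E})
  (x : {ffun V -> 'I_m}).

Definition edge_ratio T e (j k : 'I_m) : R := edge_marginal T e j k /
  (node_marginal T (src e) j * node_marginal T (tgt e) k).

Definition tree_density S F T x : R :=
  \prod_(s in S) node_marginal T s (x s) *
  \prod_(e in F) edge_ratio T e (x (src e)) (x (tgt e)).

Lemma edge_ratio_ge0 T e j k : C T -> 0 <= edge_ratio T e j k.
Proof. by move=> CT; rewrite divr_ge0 ?mulr_ge0 ?edge_marginal_ge0 ?node_marginal_ge0. Qed.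

Lemma tree_density_ge0 S F T x : C T -> 0 <= tree_density S F T x.
Proof.
move=> CT; apply: mulr_ge0; apply: prodr_ge0 => i _.
  exact: node_marginal_ge0.
exact: edge_ratio_ge0.
Qed.

Lemma tree_density_upd r S F T x v j : rooted r S F -> v \notin S ->
  tree_density S F T (upd x v j) = tree_density S F T x.
Proof.
move=> h vS; have neq u : u \in S -> u != v by apply: contraTneq => ->.
congr (_ * _); apply: eq_bigr.
  by move=> s /neq sv; rewrite upd_neq.
by move=> e /(rooted_edges h)/andP[/neq sv /neq tv]; rewrite !upd_neq.
Qed.

(** The sum is 1 if the marginal of [src e] at [j] is positive and 0 if it vanishes, division by 0
    being 0; hence an inequality. *)
Lemma edge_ratio_sum_tgt T e j : C T ->
  \sum_k node_marginal T (tgt e) k * edge_ratio T e j k <= 1.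
Proof.
move=> CT; have T0 := node_marginal_ge0 (src e) j CT; have [_ _ Es _] := CT.
apply: (@le_trans _ _ (node_marginal T (src e) j / node_marginal T (src e) j)).
  rewrite -[X in X / _]Es mulr_suml; apply: ler_sum => k _.
  have [->|Tk] := eqVneq (node_marginal T (tgt e) k) 0.
    by rewrite mul0r divr_ge0 ?edge_marginal_ge0.
  by rewrite /edge_ratio invfM [X in _ * X]mulrA mulrC divfK.
have [->|Tn] := eqVneq (node_marginal T (src e) j) 0; first by rewrite mul0r.
by rewrite divff.
Qed.

Lemma edge_ratio_sum_src T e k : C T ->
  \sum_j node_marginal T (src e) j * edge_ratio T e j k <= 1.
Proof.
move=> CT; have T0 := node_marginal_ge0 (tgt e) k CT; have [_ _ _ Et] := CT.
apply: (@le_trans _ _ (node_marginal T (tgt e) k / node_marginal T (tgt e) k)).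
  rewrite -[X in X / _]Et mulr_suml; apply: ler_sum => j _.
  have [->|Tk] := eqVneq (node_marginal T (src e) j) 0.
    by rewrite mul0r divr_ge0 ?edge_marginal_ge0.
  by rewrite /edge_ratio invfM mulrCA mulVKf.
have [->|Tn] := eqVneq (node_marginal T (tgt e) k) 0; first by rewrite mul0r.
by rewrite divff.
Qed.

(* Averaging over the leaf coordinate [v] removes [v] from the product. *)
Lemma tree_density_step r S F T e v (K : {ffun V -> 'I_m} -> R) :
  C T -> rooted r S F -> v \notin S ->
  (forall x, 0 <= K x) ->
  (forall x, \sum_j K (upd x v j) <= 1) ->
  m%:R * \sum_x (K x * tree_density S F T x) <= \sum_x tree_density S F T x.
Proof.
move=> CT h vS K0 K1; rewrite -(sum_upd _ v); apply: ler_sum => x _.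
under eq_bigr do rewrite (tree_density_upd _ _ _ h vS).
by rewrite -mulr_suml ler_piMl// tree_density_ge0.
Qed.

(** The sum runs over all coordinates while the density depends only on those in [S], so each
    coordinate outside [S] counts [m] times. Powers on both sides avoid the exponent
    [#|V| - #|S|]. *)
Lemma rooted_tree_density_sum r S F T : C T -> rooted r S F ->
  m%:R ^+ #|S| * \sum_x tree_density S F T x <= m%:R ^+ #|V|.
Proof.
move=> CT; have cardX : \sum_(x : {ffun V -> 'I_m}) (1 : R) = m%:R ^+ #|V|.
  by rewrite sumr_const card_ffun card_ord natrX.
elim=> {S F} [|S F e h IH eS eS'|S F e h IH eS eS'].
- rewrite cards1 expr1 -(sum_upd _ r) -cardX; apply: ler_sum => x _.
  rewrite /tree_density; under eq_bigr do rewrite big_set1 big_set0 mulr1 upd_same.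
  by have [_ -> _ _] := CT.
- have eF : e \notin F by apply: contra eS' => /(rooted_edges h)/andP[].
  apply: le_trans IH; rewrite cardsU1 eS' add1n exprSr -mulrA.
  rewrite ler_wpM2l ?exprn_ge0//.
  under eq_bigr do rewrite /tree_density !big_setU1//= mulrACA.
  apply: (tree_density_step e CT h eS') => x.
    by rewrite mulr_ge0 ?edge_ratio_ge0 ?node_marginal_ge0.
  under eq_bigr do rewrite upd_same upd_neq ?(memPn eS')//.
  exact: edge_ratio_sum_tgt.
- have eF : e \notin F by apply: contra eS' => /(rooted_edges h)/andP[].
  apply: le_trans IH; rewrite cardsU1 eS' add1n exprSr -mulrA.
  rewrite ler_wpM2l ?exprn_ge0//.
  under eq_bigr do rewrite /tree_density !big_setU1//= mulrACA.
  apply: (tree_density_step e CT h eS') => x.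
    by rewrite mulr_ge0 ?edge_ratio_ge0 ?node_marginal_ge0.
  under eq_bigr do rewrite upd_same upd_neq ?(memPn eS')//.
  exact: edge_ratio_sum_src.
Qed.

Lemma tree_density_sum_le1 F T : (0 < m)%N -> C T -> spanning_tree F ->
  \sum_x tree_density [set: V] F T x <= 1.
Proof.
(* If [V] is empty there is one configuration, of density 1. *)
move=> m0 CT F_tree; case: (pickP V) => [r _|V0]; last first.
  rewrite (eq_bigr (fun=> 1)) => [|x _].
    by rewrite sumr_const card_ffun (eq_card0 V0) expn0.
  rewrite /tree_density !big1 ?mulr1// => i; first by have := V0 (src i).
  by have := V0 i.
have := rooted_tree_density_sum CT (spanning_tree_rooted g_irr gE r F_tree).
by rewrite cardsT ger_pMr// exprn_gt0// ltr0n.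
Qed.

(** * Marginals of a positive distribution *)

Section Marginals.
Variables (p : {ffun V -> 'I_m} -> R).
Hypotheses (p_gt0 : forall x, 0 < p x) (p_sum1 : \sum_x p x = 1).

Definition marginals : point := [ffun a => \sum_x p x * potential R a x].

(** An expectation depending on one coordinate is computed from its marginal; used with [f] constant
    for normalization and with [f] a logarithm for entropy. *)
Lemma node_marginal_sum s (f : 'I_m -> R) :
  \sum_j node_marginal marginals s j * f j = \sum_x p x * f (x s).
Proof.
under eq_bigr do rewrite /node_marginal ffunE mulr_suml.
rewrite exchange_big; apply: eq_bigr => x _ /=.
rewrite (bigD1 (x s))//= big1 ?addr0 ?eqxx ?mulr1// => j.
by rewrite eq_sym => /negbTE ->; rewrite mulr0 mul0r.
Qed.

Lemma edge_marginal_sum e (f : 'I_m -> 'I_m -> R) :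
  \sum_j \sum_k edge_marginal marginals e j k * f j k =
  \sum_x p x * f (x (src e)) (x (tgt e)).
Proof.
rewrite pair_bigA; under eq_bigr do rewrite /edge_marginal ffunE mulr_suml.
rewrite exchange_big; apply: eq_bigr => x _ /=.
rewrite (bigD1 (x (src e), x (tgt e)))//= big1 ?addr0 ?eqxx ?mulr1// => -[j k].
by rewrite xpair_eqE ![_ == x _]eq_sym => /negbTE ->; rewrite mulr0 mul0r.
Qed.

Lemma marginals_pseudomarginals : C marginals.
Proof.
split.
- move=> a; rewrite ffunE sumr_ge0// => x _; rewrite mulr_ge0 ?(ltW (p_gt0 x))//.
  by case: a => [[s j]|[e [j k]]]; exact: ler0n.
- move=> s; under eq_bigr do rewrite -[node_marginal _ _ _]mulr1.
  by rewrite (node_marginal_sum s (fun=> 1)); under eq_bigr do rewrite mulr1.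
- move=> e j; rewrite /edge_marginal /node_marginal ffunE.
  under eq_bigr do rewrite ffunE.
  rewrite exchange_big; apply: eq_bigr => x _; rewrite -mulr_sumr /=; congr (_ * _).
  rewrite (bigD1 (x (tgt e)))//= eqxx andbT big1 ?addr0// => k.
  by rewrite eq_sym => /negbTE ->; rewrite andbF.
- move=> e k; rewrite /edge_marginal /node_marginal ffunE.
  under eq_bigr do rewrite ffunE.
  rewrite exchange_big; apply: eq_bigr => x _; rewrite -mulr_sumr /=; congr (_ * _).
  rewrite (bigD1 (x (src e)))//= eqxx andTb big1 ?addr0// => j.
  by rewrite eq_sym => /negbTE ->.
Qed.

Lemma node_marginal_gt0 s x : 0 < node_marginal marginals s (x s).
Proof.
rewrite /node_marginal ffunE (bigD1 x)//= eqxx mulr1 ltr_wpDr ?p_gt0//.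
by rewrite sumr_ge0// => y _; rewrite mulr_ge0 ?ler0n// ltW.
Qed.

Lemma edge_marginal_gt0 e x : 0 < edge_marginal marginals e (x (src e)) (x (tgt e)).
Proof.
rewrite /edge_marginal ffunE (bigD1 x)//= !eqxx mulr1 ltr_wpDr ?p_gt0//.
by rewrite sumr_ge0// => y _; rewrite mulr_ge0 ?ler0n// ltW.
Qed.

Lemma edge_ratio_gt0 e x : 0 < edge_ratio marginals e (x (src e)) (x (tgt e)).
Proof. by rewrite divr_gt0 ?mulr_gt0 ?node_marginal_gt0 ?edge_marginal_gt0. Qed.

Lemma tree_density_gt0 S F x : 0 < tree_density S F marginals x.
Proof.
apply: mulr_gt0; apply: prodr_gt0 => i _; first exact: node_marginal_gt0.
exact: edge_ratio_gt0.
Qed.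

(** The logarithm splits the density into functions of one node or one edge, whose expectations
    involve only the marginals. *)
Lemma cross_entropy_tree S F :
  \sum_x p x * ln (tree_density S F marginals x) = tree_energy S F marginals.
Proof.
transitivity (\sum_x (\sum_(s in S) p x * ln (node_marginal marginals s (x s)) +
    \sum_(e in F) p x * ln (edge_ratio marginals e (x (src e)) (x (tgt e))))).
  apply: eq_bigr => x _; rewrite -!mulr_sumr -mulrDr; congr (_ * _).
  rewrite lnM ?posrE ?prodr_gt0//; last 2 first.
  - by move=> s _; exact: node_marginal_gt0.
  - by move=> e _; exact: edge_ratio_gt0.
  rewrite !ln_prod// => [e _|s _]; [exact: edge_ratio_gt0|exact: node_marginal_gt0].
rewrite big_split /= /tree_energy; congr (_ + _); rewrite exchange_big /=.
  rewrite -sumrN; apply: eq_bigr => s _.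
  by rewrite /entropy opprK (node_marginal_sum s (fun j => ln (node_marginal marginals s j))).
apply: eq_bigr => e _.
by rewrite /mutual_information (edge_marginal_sum e (fun j k => ln (edge_ratio marginals e j k))).
Qed.

Lemma tree_energy_le_neg_entropy F : (0 < m)%N -> spanning_tree F ->
  tree_energy [set: V] F marginals <= \sum_x p x * ln (p x).
Proof.
move=> m0 F_tree; rewrite -cross_entropy_tree; apply: gibbs_ineq => //.
  by move=> x; exact: tree_density_gt0.
exact: (tree_density_sum_le1 m0 marginals_pseudomarginals F_tree).
Qed.

End Marginals.

(** The witness is the vector of marginals of the Gibbs distribution [p = exp w / Z]. Since [ln p]
    is [w] minus the log partition function, the tree bounds averaged with weights [nu] give the
    claim. *)
Lemma log_partition_le (theta : point) (mu : {ffun edge E -> R}) :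
  (0 < m)%N -> spanning_tree_polytope R E mu ->
  exists2 T, C T & log_partition theta <= - free_energy mu theta T.
Proof.
move=> m0 [nu [nu0 nu1 muE]].
pose w x := \sum_(a : model_index E m) theta a * potential R a x.
pose Z := \sum_x expR (w x).
have Z0 : 0 < Z.
  (* As [m] is positive there is a constant configuration, which makes [Z] positive. *)
  rewrite /Z (bigD1 [ffun=> Ordinal m0])//= ltr_wpDr ?expR_gt0//.
  by rewrite sumr_ge0// => x _; exact: expR_ge0.
pose p x := expR (w x) / Z.
have p0 x : 0 < p x by rewrite divr_gt0 ?expR_gt0.
have p1 : \sum_x p x = 1 by rewrite -mulr_suml divff ?gt_eqF.
exists (marginals p); first exact: marginals_pseudomarginals.
rewrite (free_energy_trees theta nu1 muE).
have -> : \sum_a marginals p a * theta a = \sum_x p x * w x.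
  under eq_bigr do rewrite ffunE mulr_suml.
  rewrite exchange_big; apply: eq_bigr => x _; rewrite mulr_sumr.
  by apply: eq_bigr => a _; rewrite -mulrA [potential _ _ _ * _]mulrC.
have lnp : \sum_x p x * ln (p x) = \sum_x p x * w x - log_partition theta.
  under eq_bigr do rewrite ln_div ?posrE ?expR_gt0// expRK mulrBr.
  by rewrite sumrB -mulr_suml p1 mul1r.
suff : \sum_(F | `[< spanning_tree F >]) nu F * tree_energy [set: V] F (marginals p)
    <= \sum_x p x * ln (p x) by rewrite lnp; lra.
rewrite -[leRHS]mul1r -nu1 mulr_suml; apply: ler_sum => F /asboolP F_tree.
by rewrite ler_wpM2l ?nu0// tree_energy_le_neg_entropy.
Qed.

End TreeDensity.

(** * Existence of a minimizer *)

Section PointwiseContinuity.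
Variables (R : realType) (X : topologicalType).
Implicit Types f h : X -> R.

(* The library versions are about [f + h] in the ring of functions, which does not
   unify with a pointwise sum. *)
Lemma fun_addr_continuous f h : continuous f -> continuous h ->
  continuous (fun x => f x + h x).
Proof. by move=> fc hc x; exact: continuousD (fc x) (hc x). Qed.

Lemma fun_subr_continuous f h : continuous f -> continuous h ->
  continuous (fun x => f x - h x).
Proof. by move=> fc hc x; exact: continuousB (fc x) (hc x). Qed.

Lemma fun_mulr_continuous f h : continuous f -> continuous h ->
  continuous (fun x => f x * h x).
Proof. by move=> fc hc x; exact: continuousM (fc x) (hc x). Qed.

End PointwiseContinuity.

Lemma sum_continuous (R : realType) (X : topologicalType) (I : finType) (P : pred I)
    (f : I -> X -> R) : (forall i, continuous (f i)) ->
  continuous (fun x => \sum_(i | P i) f i x).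
Proof. by move=> fc; apply: continuous_big => //; exact: add_continuous. Qed.

Lemma closed_forall_ge0 (R : realType) (X : topologicalType) (I : Type)
    (f : I -> X -> R) : (forall i, continuous (f i)) ->
  closed [set x | forall i, 0 <= f i x].
Proof.
move=> fc; have -> : [set x | forall i, 0 <= f i x] =
    \bigcap_(i in setT) (f i @^-1` [set y | 0 <= y]).
  by apply/seteqP; split => x h i; [move=> _|]; exact: h.
apply: closed_bigI => i _; apply: preimage_closed; last exact: closed_ge.
by move=> x _; exact: fc.
Qed.

Lemma closed_forall_eq (R : realType) (X : topologicalType) (I : Type)
    (f h : I -> X -> R) : (forall i, continuous (f i)) -> (forall i, continuous (h i)) ->
  closed [set x | forall i, f i x = h i x].
Proof.
move=> fc hc; have -> : [set x | forall i, f i x = h i x] =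
    \bigcap_(i in setT) ((fun x => f i x - h i x) @^-1` [set y | y = 0]).
  apply/seteqP; split => x /=.
    by move=> e i _; apply/eqP; rewrite subr_eq0 e.
  by move=> e i; apply/eqP; rewrite -subr_eq0; apply/eqP; exact: e.
apply: closed_bigI => i _; apply: preimage_closed; last exact: closed_eq.
by move=> x _; apply: continuousB; [exact: fc|exact: hc].
Qed.

(** * Compactness and continuity on the local polytope *)

Section Existence.
Variables (R : realType) (V : finType) (E : {set V * V}) (m : nat).
Local Notation point := {ffun model_index E m -> R^o}.
Local Notation C := (pseudomarginals R E m).
Implicit Types (T : point) (e : edge E).

Definition xlnx (x : R) : R := x * ln x.

(* On [C] this agrees with [mutual_information], but unlike the latter it is
   continuous everywhere. *)
Definition mutual_information_xlnx T e : R :=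
  \sum_(j < m) \sum_(k < m) xlnx (edge_marginal T e j k)
  - \sum_(j < m) xlnx (node_marginal T (src e) j)
  - \sum_(k < m) xlnx (node_marginal T (tgt e) k).

Lemma mutual_information_xlnxE T e : C T ->
  mutual_information T e = mutual_information_xlnx T e.
Proof.
move=> CT; rewrite mutual_information_tgt// /neg_cond_entropy /entropy.
congr (_ - _); have [_ _ Es _] := CT; rewrite -sumrB; apply: eq_bigr => j _.
rewrite /xlnx -[X in _ = _ - X * _]Es mulr_suml -sumrB; apply: eq_bigr => k _.
rewrite /klterm /=.
have [->|Te] := eqVneq (edge_marginal T e j k) 0; first by rewrite !mul0r subrr.
have Te0 : 0 < edge_marginal T e j k by rewrite lt_def Te edge_marginal_ge0.
have Ts0 := lt_le_trans Te0 (edge_marginal_le_src e j k CT).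
by rewrite ln_div ?posrE// mulrBr.
Qed.

(** Points are given coordinates by enumerating the index set, because compactness of boxes and the
    extreme value theorem are applied to row vectors. *)
Definition point_of_row (v : 'rV[R]_#|model_index E m|) : point :=
  [ffun a => v ord0 (enum_rank a)].

Lemma point_of_row_surj T : point_of_row (\row_i T (enum_val i)) = T.
Proof. by apply/ffunP => a; rewrite ffunE mxE enum_rankK. Qed.

Lemma point_of_row_continuous a : continuous (fun v => point_of_row v a : R).
Proof.
have -> : (fun v => point_of_row v a : R) =
    (fun v : 'rV_#|model_index E m| => v ord0 (enum_rank a)).
  by apply/funext => v; rewrite ffunE.
exact: coord_continuous.
Qed.

Lemma xlnx_point_continuous a : continuous (fun v => xlnx (point_of_row v a)).
Proof.
move=> v; apply: (@continuous_comp _ _ _ (fun v => point_of_row v a : R) xlnx).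
  exact: point_of_row_continuous.
exact: xlnx_continuous.
Qed.

(** Closed, being cut out by weak inequalities and equations between continuous functions, and
    contained in the unit cube: normalization bounds the node entries, which dominate the edge
    entries. *)
Lemma pseudomarginals_compact : compact (point_of_row @^-1` C).
Proof.
have pc := point_of_row_continuous.
have Ccl : closed (point_of_row @^-1` C).
  have -> : point_of_row @^-1` C =
    [set v | forall a, 0 <= point_of_row v a] `&`
    [set v | forall s, \sum_j node_marginal (point_of_row v) s j = 1] `&`
    [set v | forall ej : edge E * 'I_m, \sum_k edge_marginal (point_of_row v) ej.1 ej.2 k
       = node_marginal (point_of_row v) (src ej.1) ej.2] `&`
    [set v | forall ek : edge E * 'I_m, \sum_j edge_marginal (point_of_row v) ek.1 j ek.2
       = node_marginal (point_of_row v) (tgt ek.1) ek.2].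
    apply/seteqP; split => v /=.
      by move=> [h1 h2 h3 h4]; do !split.
    move=> [[[h1 h2] h3] h4]; split => //.
      by move=> e j; exact: (h3 (e, j)).
    by move=> e j; exact: (h4 (e, j)).
  apply: closedI; [apply: closedI; [apply: closedI|]|].
  - exact: closed_forall_ge0.
  - apply: closed_forall_eq => s; last exact: cst_continuous.
    by apply: sum_continuous => j; exact: pc.
  - apply: closed_forall_eq => -[e j]; last exact: pc.
    by apply: sum_continuous => k; exact: pc.
  - apply: closed_forall_eq => -[e k]; last exact: pc.
    by apply: sum_continuous => j; exact: pc.
have box := @rV_compact R #|model_index E m| (fun=> `[0, 1]%classic)
  (fun=> @segment_compact R 0 1).
apply: (subclosed_compact Ccl box) => v Cv i /=.
have vi : v ord0 i = point_of_row v (enum_val i) by rewrite ffunE enum_valK.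
have [T0 T1 _ _] := Cv.
rewrite vi in_itv /= T0 /=.
have node_le1 s j : node_marginal (point_of_row v) s j <= 1.
  by rewrite -(T1 s) (bigD1 j)//= lerDl sumr_ge0// => k _; exact: T0.
case: (enum_val i) => [[s j]|[e [j k]]]; first exact: node_le1.
exact: le_trans (edge_marginal_le_src e j k Cv) (node_le1 _ _).
Qed.

Variables (theta : point) (mu : {ffun edge E -> R}).

Lemma free_energy_continuous :
  {within point_of_row @^-1` C, continuous (free_energy mu theta \o point_of_row)}.
Proof.
pose f v : R := \sum_(s : V) \sum_(j < m) xlnx (node_marginal (point_of_row v) s j)
  + \sum_(e : edge E) mu e * mutual_information_xlnx (point_of_row v) e
  - \sum_a point_of_row v a * theta a.
have fE : {in point_of_row @^-1` C, f =1 free_energy mu theta \o point_of_row}.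
  move=> v; rewrite inE => Cv; rewrite /f /free_energy /=; congr (_ + _ - _).
    by rewrite -sumrN; apply: eq_bigr => s _; rewrite opprK.
  by apply: eq_bigr => e _; rewrite mutual_information_xlnxE.
apply: (subspace_eq_continuous fE); apply: continuous_subspaceT; rewrite /f.
have xc a := xlnx_point_continuous a.
apply: fun_subr_continuous; first apply: fun_addr_continuous.
- by do 2 apply: sum_continuous => ?; exact: xc.
- apply: sum_continuous => e; apply: fun_mulr_continuous; first exact: cst_continuous.
  apply: fun_subr_continuous; first apply: fun_subr_continuous.
  + by do 2 apply: sum_continuous => ?; exact: xc.
  + by apply: sum_continuous => ?; exact: xc.
  + by apply: sum_continuous => ?; exact: xc.
- apply: sum_continuous => a; apply: fun_mulr_continuous; last exact: cst_continuous.
  exact: point_of_row_continuous.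
Qed.

Lemma free_energy_minimizer_exists : C !=set0 ->
  exists T, is_minimizer C (free_energy mu theta) T.
Proof.
move=> [T0 CT0].
have C0 : point_of_row @^-1` C !=set0.
  by exists (\row_i T0 (enum_val i)); rewrite /preimage /= point_of_row_surj.
have [v Cv minv] := EVT_min_rV C0 pseudomarginals_compact free_energy_continuous.
exists (point_of_row v); split; first by move: Cv; rewrite inE.
move=> T CT; rewrite -(point_of_row_surj T); apply: minv.
by rewrite inE /preimage /= point_of_row_surj.
Qed.

End Existence.

(** * Convexity, unique minimizer and upper bound *)

Theorem theorem1 (R : realType) (V : finType) (g : rel V)
    (g_sym : symmetric g) (g_irr : irreflexive g) (g_conn : connected_rel g)
    (E : {set V * V}) (gE : orientation g E)
    (m : nat) (m_gt0 : (0 < m)%N)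
    (theta : {ffun model_index E m -> R^o})
    (mu : {ffun edge E -> R}) (mu_T : spanning_tree_polytope R E mu)
    (mu_gt0 : forall e : edge E, 0 < mu e) :
  [/\ convex_set (pseudomarginals R E m),
      convex_function (pseudomarginals R E m) (free_energy mu theta) &
      exists That : {ffun model_index E m -> R^o},
        [/\ is_minimizer (pseudomarginals R E m) (free_energy mu theta) That,
            forall T : {ffun model_index E m -> R^o},
              is_minimizer (pseudomarginals R E m) (free_energy mu theta) T ->
              T = That &
            log_partition theta <= - free_energy mu theta That]].
Proof.
have [nu [nu0 nu1 muE]] := mu_T.
have t01 (t : {i01 R}) : 0 <= t%:num <= 1 by rewrite ge0 le1.
split.
(* The convex combination in [convex_set] unfolds to [mix]. *)
- move=> T T' t; rewrite !inE => CT CT'.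
  exact: (pseudomarginals_mix (t01 t) CT CT').
- move=> t T T'; rewrite !inE => CT CT'.
  exact: (free_energy_convex g_irr gE theta nu0 nu1 muE (t01 t) CT CT').
have [T CT boundT] := log_partition_le g_irr gE theta m_gt0 mu_T.
(* The point found for the bound also shows that the polytope is nonempty. *)
have [That minT] := free_energy_minimizer_exists theta mu (ex_intro _ T CT).
exists That; split => //.
  move=> T' minT'.
  exact: (free_energy_minimizer_unique g_irr gE nu0 nu1 muE mu_gt0 minT' minT).
by apply: le_trans boundT _; rewrite lerN2; exact: minT.2.
Qed.
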